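(* Let $K\subseteq\mathbb{R}^n$ be a nonempty closed convex cone, $b\in\mathbb{R}^m$, and let $A\in\mathbb{R}^{m\times n}$ have full rank with $m\le n$. Let $T_2$ be the operator defined in the context and let $v$ be its infimal displacement vector. Consider the iteration $z^{k+1}=T_2(z^k)$, $k=0,1,\dots$, with any starting point $z^0\in\mathbb{R}^n$. Then $z^k-z^{k+1}\to v$, and: 1. (P) is strongly infeasible if and only if $v\ne\mathbf{0}$. 2. (P) is weakly infeasible or feasible if and only if $v=\mathbf{0}$.
   Context: A set $K\subseteq\mathbb{R}^n$ is a cone if $K=\lambda K$ for every $\lambda>0$. $\|\cdot\|$ is the Euclidean norm and $d(C_1,C_2)=\inf\{\|x-y\|\mid x\in C_1,\ y\in C_2\}$. (P) is the problem: minimize $c^Tx$ subject to $Ax=b$, $x\in K$ (for some $c\in\mathbb{R}^n$). It is feasible if $K\cap\{x\mid Ax=b\}\ne\emptyset$ and infeasible otherwise. When infeasible, it is strongly infeasible if $d(K,\{x\mid Ax=b\})>0$ and weakly infeasible if $d(K,\{x\mid Ax=b\})=0$. For a nonempty closed convex set $C$, $P_C$ is the Euclidean projection onto $C$ and $R_C(x)=2P_C(x)-x$. $\mathcal{N}(A)$ is the null space of $A$. Define $\tilde T(z)=\frac12\left(z+R_{\mathcal{N}(A)}(R_K(z))\right)$, $x_0=A^T(AA^T)^{-1}b$, and $T_2(z)=\tilde T(z)+x_0$. An operator $T:\mathbb{R}^n\to\mathbb{R}^n$ is firmly nonexpansive if $\|T(x)-T(y)\|^2\le\|x-y\|^2-\|(I-T)(x)-(I-T)(y)\|^2$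 for all $x,y$; $T_2$ is firmly nonexpansive. For a firmly nonexpansive $T$, the closure $\overline{\mathrm{ran}(I-T)}$ of $\mathrm{ran}(I-T)=\{x-T(x)\mid x\in\mathbb{R}^n\}$ is convex, and the infimal displacement vector of $T$ is $P_{\overline{\mathrm{ran}(I-T)}}(\mathbf{0})$. *)

(* Defs.v *)
(* MathComp-Analysis, over an arbitrary [R : realType]; R^n is ['cV[R]_n]. *)
From HB Require Import structures.
From mathcomp Require Import all_boot all_order all_algebra.
From mathcomp Require Import all_classical all_reals all_analysis.

Set Implicit Arguments.
Unset Strict Implicit.
Unset Printing Implicit Defensive.

Import Order.TTheory GRing.Theory Num.Theory.
Import numFieldNormedType.Exports.

Local Open Scope classical_set_scope.
Local Open Scope ring_scope.

(* The library norm [`|x|] on matrices is the max norm.  Its topology, which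
   underlies [closed], [closure] and [-->] below, is the Euclidean one. *)
Definition enorm (R : realType) (n : nat) (x : 'cV[R]_n) : R :=
  Num.sqrt (\sum_(i < n) x i 0 ^+ 2).

Definition set_dist (R : realType) (n : nat) (C1 C2 : set 'cV[R]_n) : \bar R :=
  ereal_inf [set (enorm (x - y))%:E | x in C1 & y in C2].

Definition is_cone (R : realType) (n : nat) (K : set 'cV[R]_n) : Prop :=
  forall lambda : R, 0 < lambda -> K = [set lambda *: x | x in K].

Definition is_projection (R : realType) (n : nat) (C : set 'cV[R]_n)
    (x p : 'cV[R]_n) : Prop :=
  C p /\ forall y, C y -> enorm (x - p) <= enorm (x - y).

(* The minimizer exists and is unique when [C] is nonempty, closed and convex;
   the default value [x] only matters when no minimizer exists. *)
Definition proj (R : realType) (n : nat) (C : set 'cV[R]_n)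
    (x : 'cV[R]_n) : 'cV[R]_n :=
  xget x (is_projection C x).

Definition reflection (R : realType) (n : nat) (C : set 'cV[R]_n)
    (x : 'cV[R]_n) : 'cV[R]_n :=
  2%:R *: proj C x - x.

(* minimize [c^T x] subject to [A x = b], [x \in K] *)
Record conic_program (R : realType) (m n : nat) := ConicProgram {
  cp_c : 'cV[R]_n;
  cp_A : 'M[R]_(m, n);
  cp_b : 'cV[R]_m;
  cp_K : set 'cV[R]_n
}.

Definition affine_set (R : realType) (m n : nat) (A : 'M[R]_(m, n))
    (b : 'cV[R]_m) : set 'cV[R]_n :=
  [set x | A *m x = b].

Definition null_space (R : realType) (m n : nat) (A : 'M[R]_(m, n)) :
    set 'cV[R]_n :=
  [set x | A *m x = 0].

Definition feasible (R : realType) (m n : nat) (P : conic_program R m n) :=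
  cp_K P `&` affine_set (cp_A P) (cp_b P) !=set0.

Definition infeasible (R : realType) (m n : nat) (P : conic_program R m n) :=
  ~ feasible P.

Definition strongly_infeasible (R : realType) (m n : nat)
    (P : conic_program R m n) : Prop :=
  infeasible P /\ (0 < set_dist (cp_K P) (affine_set (cp_A P) (cp_b P)))%E.

Definition weakly_infeasible (R : realType) (m n : nat)
    (P : conic_program R m n) : Prop :=
  infeasible P /\ set_dist (cp_K P) (affine_set (cp_A P) (cp_b P)) = 0%E.

Definition Ttilde (R : realType) (m n : nat) (K : set 'cV[R]_n)
    (A : 'M[R]_(m, n)) (z : 'cV[R]_n) : 'cV[R]_n :=
  2%:R^-1 *: (z + reflection (null_space A) (reflection K z)).

Definition x0 (R : realType) (m n : nat) (A : 'M[R]_(m, n))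
    (b : 'cV[R]_m) : 'cV[R]_n :=
  A^T *m invmx (A *m A^T) *m b.

Definition T2 (R : realType) (m n : nat) (K : set 'cV[R]_n)
    (A : 'M[R]_(m, n)) (b : 'cV[R]_m) (z : 'cV[R]_n) : 'cV[R]_n :=
  Ttilde K A z + x0 A b.

Definition infimal_displacement (R : realType) (n : nat)
    (T : 'cV[R]_n -> 'cV[R]_n) : 'cV[R]_n :=
  proj (closure (range (fun x => x - T x))) 0.

(* Main.v *)
Require Import Defs.
From HB Require Import structures.
From mathcomp Require Import all_boot all_order all_algebra ring lra.
From mathcomp Require Import all_classical all_reals all_analysis.

Set Implicit Arguments.
Unset Strict Implicit.
Unset Printing Implicit Defensive.

Import Order.TTheory GRing.Theory Num.Theory.
Import numFieldNormedType.Exports.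

Local Open Scope classical_set_scope.
Local Open Scope ring_scope.

(** Write [Q = A^T (A A^T)^-1 A] for the orthogonal projector onto the row
    space of [A], so that [1 - Q] projects onto the null space, and [p] for the
    projection of [z] on [K].  Expanding the two reflections gives

      [z - T2 z = Q p + (1 - Q) (z - p) - x0],    with [Q x0 = x0].

    Let [v] be the point of smallest norm in the closure of the convex set
    [Q K - x0], which lies in the row space.  Two facts make [v] the infimal
    displacement vector ([exists_displacement]):
    - at a point [z = p] of [K] the displacement is exactly [Q p - x0], so [v]
      is in the closure of the range of [1 - T2];
    - against a vector of the row space only the part [Q p - x0] of a
      displacement counts, so the variational inequality that characterizes
      [v] among the points of [Q K - x0] extends to all displacements:
      [|v|^2 <= <z - T2 z, v>] for every [z].

    The second fact also gives the limit of [z^k - z^(k+1)]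
    ([cvg_displacement]).  It bounds the distance from a displacement [d] to
    [v] by [|d - v|^2 <= |d|^2 - |v|^2].  An orbit [y^k] started at a point
    whose displacement is almost as short as [v] keeps that property, because
    [T2] is nonexpansive, and firm nonexpansiveness makes the displacements of
    any other orbit [z^k] asymptotic to those of [y^k]: the squared norms of
    their differences are bounded by the decrements of the convergent sequence
    [|z^k - y^k|^2].

    Finally [Q (x - y) = Q x - x0] when [A y = b], and this vector is attained
    as a difference [x - y], so the distance from [K] to [{y | A y = b}] is the
    distance from [0] to [Q K - x0], that is, the norm of [v].  Strong
    infeasibility is the positivity of this distance. *)

(** * Euclidean geometry and its topology *)

Section Euclidean.
Variables (R : realType) (n : nat).
Implicit Types (x y z p u v : 'cV[R]_n) (C : set 'cV[R]_n).

Definition dot x y : R := (x^T *m y) 0 0.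

Lemma dotE x y : dot x y = \sum_i x i 0 * y i 0.
Proof. by rewrite /dot mxE; apply: eq_bigr => i _; rewrite mxE. Qed.

Lemma dotC x y : dot x y = dot y x.
Proof. by rewrite !dotE; apply: eq_bigr => i _; rewrite mulrC. Qed.

Lemma dotDl x y z : dot (x + y) z = dot x z + dot y z.
Proof. by rewrite /dot linearD mulmxDl mxE. Qed.

Lemma dotDr x y z : dot z (x + y) = dot z x + dot z y.
Proof. by rewrite /dot mulmxDr mxE. Qed.

Lemma dotZl a x y : dot (a *: x) y = a * dot x y.
Proof. by rewrite /dot linearZ -scalemxAl mxE. Qed.

Lemma dotZr a x y : dot x (a *: y) = a * dot x y.
Proof. by rewrite dotC dotZl dotC. Qed.

Lemma dotNl x y : dot (- x) y = - dot x y.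
Proof. by rewrite -scaleN1r dotZl mulN1r. Qed.

Lemma dotNr x y : dot x (- y) = - dot x y.
Proof. by rewrite dotC dotNl dotC. Qed.

Definition dot_lin := (dotDl, dotDr, dotNl, dotNr, dotZl, dotZr).

Lemma dot0r x : dot x 0 = 0.
Proof. by rewrite -(scale0r x) dotZr mul0r. Qed.

Lemma dot_ge0 x : 0 <= dot x x.
Proof. by rewrite dotE sumr_ge0// => i _; rewrite -expr2 sqr_ge0. Qed.

Lemma coord_sqr_le_dot x i : x i 0 ^+ 2 <= dot x x.
Proof.
rewrite dotE (bigD1 i)//= expr2 lerDl sumr_ge0// => j _.
by rewrite -expr2 sqr_ge0.
Qed.

Lemma dot_eq0 x : dot x x = 0 -> x = 0.
Proof.
move=> x0; apply/matrixP => i j; rewrite ord1 mxE; apply/eqP.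
by rewrite -sqrf_eq0 eq_le sqr_ge0 andbT -x0 coord_sqr_le_dot.
Qed.

Lemma enormE x : enorm x = Num.sqrt (dot x x).
Proof. by rewrite /enorm dotE; under eq_bigr do rewrite expr2. Qed.

Lemma enorm_le x y : (enorm x <= enorm y) = (dot x x <= dot y y).
Proof. by rewrite !enormE ler_sqrt// dot_ge0. Qed.

(** Balls are those of the max norm, which the Euclidean norm dominates. *)
Lemma ball_dot x y (e : R) : 0 < e -> dot (x - y) (x - y) < e ^+ 2 -> ball x e y.
Proof.
move=> e0 xye; split=> // i j; rewrite ord1 /ball/=.
rewrite -ltr_sqr ?nnegrE ?(ltW e0)// real_normK ?num_real//.
by apply: le_lt_trans xye; have := coord_sqr_le_dot (x - y) i; rewrite !mxE.
Qed.

Lemma cvg_dot (T : Type) (F : set_system T) (f g : T -> 'cV[R]_n) x y :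
  Filter F -> f @ F --> x -> g @ F --> y ->
  (fun t => dot (f t) (g t)) @ F --> dot x y.
Proof.
move=> FF fx gy; rewrite dotE.
under eq_fun do rewrite dotE.
apply: cvg_big => [|i _]; first exact: add_continuous.
apply: cvgM.
  apply: (cvg_comp _ (fun M : 'cV[R]_n => M i 0) fx).
  exact: coord_continuous.
apply: (cvg_comp _ (fun M : 'cV[R]_n => M i 0) gy).
exact: coord_continuous.
Qed.

Lemma sqnorm_continuous : continuous (fun x => dot x x).
Proof.
by move=> x; apply: (@cvg_dot _ (nbhs x) id id); exact: cvg_id.
Qed.

(** Convergence in the coordinatewise topology is convergence in squared
    Euclidean norm; this and [closure_dotP] are where the two norms on
    ['cV_n] meet. *)
Lemma cvg_dotP (T : Type) (F : set_system T) (f : T -> 'cV[R]_n) x :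
  Filter F ->
  f @ F --> x <->
  forall e : R, 0 < e -> \forall t \near F, dot (f t - x) (f t - x) < e.
Proof.
move=> FF; split=> [fx e e0|fx].
  have h : (fun t => dot (f t - x) (f t - x)) @ F --> dot (x - x) (x - x).
    by apply: cvg_dot; apply: cvgB => //; exact: cvg_cst.
  rewrite subrr dot0r in h.
  exact: cvgr_lt h _ _.
apply/cvg_ballP => e e0; near=> t.
apply/ball_sym/ball_dot => //; near: t; apply: fx.
by rewrite exprn_gt0.
Unshelve. all: by end_near. Qed.

Lemma closure_dotP C x :
  closure C x <-> forall e : R, 0 < e -> exists2 y, C y & dot (y - x) (y - x) < e.
Proof.
split=> [Cx e e0|Cx B /nbhs_ballP[e/= e0 eB]].
  have /cvg_dotP/(_ e e0)/Cx[y []] : id @ nbhs x --> x by exact: cvg_id.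
  by exists y.
have [|y Cy yx] := Cx (e ^+ 2); first by rewrite exprn_gt0.
by exists y; split=> //; apply/eB/ball_sym/ball_dot.
Qed.

Lemma convex_setE C x y (t : R) : convex_set C -> C x -> C y ->
  0 <= t <= 1 -> C (t *: x + (1 - t) *: y).
Proof.
move=> cC Cx Cy /andP[t0 t1].
by have := cC x y (Itv01 t0 t1); rewrite !inE; apply.
Qed.

(** * Projections on convex sets *)

(** A minimizing sequence in [C] is Cauchy by the parallelogram law, since the
    midpoint of two almost nearest points is not nearer to [x]; its limit is
    [p].  The inequality at [y] in [C] comes from comparing the sequence with
    the points at parameter [t] on the segments towards [y], letting the
    sequence converge first and choosing [t] small afterwards. *)
Lemma closure_variational_projection C x : convex_set C -> C !=set0 ->
  exists2 p, closure C p & forall y, C y -> dot (x - p) (y - p) <= 0.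
Proof.
move=> cC [c0 Cc0].
pose D := [set dot (x - y) (x - y) | y in C].
have Dlb : has_lbound D by exists 0 => _ [y _ <-]; exact: dot_ge0.
have Dinf : has_inf D by split=> //; exists (dot (x - c0) (x - c0)), c0.
have [d [d0 dlim]] : exists d : nat -> R, (forall k, 0 < d k) /\ d @ \oo --> 0.
  exists harmonic; split=> [k|]; last exact: cvg_harmonic.
  by rewrite invr_gt0.
have /choice[u uP] : forall k, exists y,
    C y /\ dot (x - y) (x - y) < inf D + d k.
  move=> k; have [_ [y Cy <-] yk] := inf_adherent (d0 k) Dinf.
  by exists y.
have infD y : C y -> inf D <= dot (x - y) (x - y).
  by move=> Cy; apply: ge_inf => //; exists y.
have : cauchy (u @ \oo).
  apply/cauchyP => e e0.
  have e20 : 0 < e ^+ 2 / 4 by rewrite divr_gt0// exprn_gt0.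
  have [N _ NP] := cvgr_lt _ dlim _ e20.
  exists (u N); suff : \forall k \near \oo, ball (u N) e (u k) by [].
  near=> k; apply: ball_dot => //.
  have kP : d k < e ^+ 2 / 4.
    by near: k; exact: cvgr_lt dlim _ _.
  have {}NP := NP _ (leqnn N).
  have [CN uN] := uP N; have [Ck uk] := uP k.
  (* the parallelogram law, through the midpoint of [u N] and [u k] *)
  have half01 : 0 <= (2^-1 : R) <= 1 by apply/andP; split; lra.
  have := infD _ (convex_setE cC CN Ck half01); move: uN uk; rewrite !dot_lin.
  rewrite (dotC (u N) x) (dotC (u k) x) (dotC (u k) (u N)).
  move=> uN uk mid; move: NP kP => /= NP kP; lra.
move=> /cauchy_cvgP/cvg_ex[p up]; exists p.
  apply: closed_cvg up; first exact: closed_closure.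
  by near=> k; apply: subset_closure; case: (uP k).
move=> y Cy.
(* The limit along the minimizing sequence, for a fixed [t]. *)
have key (t : R) : 0 < t <= 1 ->
    2 * dot (x - p) (y - p) <= t * dot (y - p) (y - p).
  move=> /andP[t0 t1].
  have cx : (fun k => 2 * dot (x - u k) (y - u k)) @ \oo -->
            2 * dot (x - p) (y - p).
    apply: cvgM; first exact: cvg_cst.
    by apply: cvg_dot; apply: cvgB => //; exact: cvg_cst.
  have cy : (fun k => t * dot (y - u k) (y - u k) + t^-1 * d k) @ \oo -->
            t * dot (y - p) (y - p) + t^-1 * 0.
    apply: cvgD; (apply: cvgM; first exact: cvg_cst).
      by apply: cvg_dot; apply: cvgB => //; exact: cvg_cst.
    exact: dlim.
  rewrite mulr0 addr0 in cy.
  apply: ler_cvg_to cx cy _; near=> k.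
  have [Ck uk] := uP k.
  have t01 : 0 <= t <= 1 by rewrite ltW.
  have mid := infD _ (convex_setE cC Cy Ck t01).
  rewrite -(ler_pM2l t0) mulrDr mulVKf ?gt_eqF//.
  move: uk mid; rewrite !dot_lin.
  rewrite (dotC (u k) x) (dotC y x) (dotC y (u k)).
  lra.
move: (dot _ _) (dot (y - p) _) (dot_ge0 (y - p)) key => a s s0 key.
rewrite leNgt; apply/negP => a0.
have as0 : 0 < a + s by lra.
(* With a = <x - p, y - p> and s = |y - p|^2, this t satisfies t s <= a. *)
have := key (a / (a + s)).
rewrite divr_gt0//= ler_pdivrMr// mul1r lerDl s0 => /(_ isT).
by rewrite mulrAC ler_pdivlMr//; nra.
Unshelve. all: by end_near. Qed.

Lemma closure_halfspace C z p : (forall y, C y -> dot z (y - p) <= 0) ->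
  forall y, closure C y -> dot z (y - p) <= 0.
Proof.
move=> Cz; have cl : closed [set y | dot z (y - p) <= 0].
  apply: (@preimage_closed _ _ (fun y => dot z (y - p)) [set t : R | t <= 0]).
    move=> y _; suff : dot z (t - p) @[t --> y] --> dot z (y - p) by [].
    apply: (@cvg_dot _ (nbhs y) (cst z) (fun t => t - p)).
      exact: cvg_cst.
    by apply: cvgB; [exact: cvg_id|exact: cvg_cst].
  exact: closed_le.
have Csub : C `<=` [set y | dot z (y - p) <= 0] by [].
by move=> y /(closureS Csub); rewrite -(closure_id _).1.
Qed.

(** The inequality gives [|x - y|^2 >= |x - p|^2 + |y - p|^2] for [y] in [C],
    so [p] is the only minimizer. *)
Lemma proj_eq C x p : C p -> (forall y, C y -> dot (x - p) (y - p) <= 0) ->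
  Defs.proj C x = p.
Proof.
move=> Cp xp; rewrite /Defs.proj.
have p_min : is_projection C x p.
  split=> // y Cy; rewrite enorm_le.
  have := xp _ Cy; have := dot_ge0 (y - p).
  rewrite -[in dot (x - y) _](subrK p x) -addrA -(opprB y p) !dot_lin.
  rewrite (dotC y x) (dotC p x) (dotC y p); lra.
have [Cq /(_ _ Cp)] := xgetPex x (ex_intro (is_projection C x) p p_min).
move: (xget _ _) Cq => q Cq; rewrite enorm_le => qp.
apply/eqP; rewrite -subr_eq0; apply/eqP/dot_eq0/le_anti; rewrite dot_ge0 andbT.
move: qp (xp _ Cq); rewrite !dot_lin (dotC q x) (dotC p x) (dotC q p); lra.
Qed.

Lemma proj_variational C x : closed C -> convex_set C -> C !=set0 ->
  C (Defs.proj C x) /\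
  forall y, C y -> dot (x - Defs.proj C x) (y - Defs.proj C x) <= 0.
Proof.
move=> clC cC C0; have [p Cp xp] := closure_variational_projection x cC C0.
by rewrite -(closure_id _).1// in Cp; rewrite (proj_eq Cp xp).
Qed.

(** Sum of the variational inequality at [x] tested on the projection of [y]
    and of the one at [y] tested on the projection of [x]. *)
Lemma proj_firm C x y : closed C -> convex_set C -> C !=set0 ->
  dot (Defs.proj C x - Defs.proj C y) (Defs.proj C x - Defs.proj C y)
  <= dot (Defs.proj C x - Defs.proj C y) (x - y).
Proof.
move=> clC cC C0.
have [Cx /(_ (Defs.proj C y))] := proj_variational x clC cC C0.
have [Cy /(_ (Defs.proj C x))] := proj_variational y clC cC C0.
move: (Defs.proj C x) (Defs.proj C y) Cx Cy => p q Cp Cq /(_ Cp) + /(_ Cq).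
rewrite !dot_lin (dotC y p) (dotC y q) (dotC x p) (dotC x q) (dotC q p); lra.
Qed.

(** * Displacements of firmly nonexpansive operators *)

Definition firmly_nonexpansive (T : 'cV[R]_n -> 'cV[R]_n) := forall x y,
  dot (T x - T y) (T x - T y) + dot (x - T x - (y - T y)) (x - T x - (y - T y))
  <= dot (x - y) (x - y).

(** The inequality on [v] gives [|d - v|^2 <= |d|^2 - |v|^2] for every
    displacement [d], so along an orbit it is enough that the norms of the
    displacements approach that of [v].  They do for an orbit started where the
    displacement is almost [v], and the displacements of two orbits merge. *)
Lemma cvg_displacement (T : 'cV[R]_n -> 'cV[R]_n) v (z : nat -> 'cV[R]_n) :
  firmly_nonexpansive T ->
  closure (range (fun x => x - T x)) v ->
  (forall x, dot v v <= dot (x - T x) v) ->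
  (forall k, z k.+1 = T (z k)) ->
  (fun k => z k - z k.+1) @ \oo --> v.
Proof.
move=> firmT vcl vle zT; apply/cvg_dotP => e e0.
have e40 : 0 < e / 4 by lra.
have [_ [[y0 _ <-] w0v]] : range (fun x => x - T x) `&`
    [set w | dot w w < dot v v + e / 4] !=set0.
  by apply: vcl; apply: cvgr_lt (@sqnorm_continuous v) _ _; rewrite ltrDl.
(* the comparison orbit: its displacements never get longer than the first *)
pose y k := iter k T y0.
have yT k : y k.+1 = T (y k) by [].
have dy k : dot (y k - y k.+1 - v) (y k - y k.+1 - v) < e / 4.
  have : dot (y k - y k.+1) (y k - y k.+1) <= dot (y0 - T y0) (y0 - T y0).
    elim: k => [//|k]; apply: le_trans.
    have := firmT (y k) (y k.+1).
    have := dot_ge0 (y k - T (y k) - (y k.+1 - T (y k.+1))).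
    rewrite -!yT; lra.
  move: (vle (y k)) w0v => /=; rewrite -yT.
  move: (y k - y k.+1) => w; move: (dot (y0 - _) _) => w0.
  rewrite !dot_lin (dotC v w); lra.
pose s k := dot (z k - y k) (z k - y k).
have sS k : dot (z k - z k.+1 - (y k - y k.+1)) (z k - z k.+1 - (y k - y k.+1))
    <= s k - s k.+1.
  by have := firmT (z k) (y k); rewrite /s -zT -yT; lra.
have s_cvg : cvgn s.
  apply: nonincreasing_is_cvgn.
    apply/nonincreasing_seqP => k; have := sS k.
    by have := dot_ge0 (z k - z k.+1 - (y k - y k.+1)); lra.
  by exists 0 => _ [k _ <-]; exact: dot_ge0.
have sB : (fun k => s k - s k.+1) @ \oo --> (0 : R).
  rewrite -(subrr (lim (s @ \oo))); apply: cvgB => //.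
  by rewrite (cvg_shiftS s).
near=> k.
have sk : s k - s k.+1 < e / 4 by near: k; exact: cvgr_lt sB _ _.
have := le_lt_trans (sS k) sk; have := dy k.
have -> : z k - z k.+1 - v = z k - z k.+1 - (y k - y k.+1) + (y k - y k.+1 - v).
  by rewrite addrA subrK.
move: (z k - z k.+1 - _) (y k - y k.+1 - v) => a c.
(* |a + c|^2 <= 2 |a|^2 + 2 |c|^2 *)
have := dot_ge0 (a - c); rewrite !dot_lin (dotC c a); lra.
Unshelve. all: by end_near. Qed.

(** [|v|^2 <= <d, v>] for all displacements [d] is the variational inequality
    of the projection of [0] on the closure of the set of displacements. *)
Lemma infimal_displacementE (T : 'cV[R]_n -> 'cV[R]_n) v :
  closure (range (fun x => x - T x)) v ->
  (forall x, dot v v <= dot (x - T x) v) ->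
  infimal_displacement T = v.
Proof.
move=> vcl vle; apply: proj_eq => //; apply: closure_halfspace => _ [x _ <-].
by have := vle x; rewrite sub0r !dot_lin (dotC v x) (dotC v (T x)); lra.
Qed.

End Euclidean.

Lemma dot_mulmx (R : realType) (m n : nat) (M : 'M[R]_(m, n)) x y :
  dot (M *m x) y = dot x (M^T *m y).
Proof. by rewrite /dot trmx_mul mulmxA. Qed.

(** * The orthogonal projector onto the row space *)

Section RowSpaceProjector.
Variables (R : realType) (m n : nat) (A : 'M[R]_(m, n)).
Hypothesis rankA : \rank A = m.

(** If [u A A^T = 0] then [|u A|^2 = 0], hence [u = 0] as the rows of [A] are
    free. *)
Lemma gram_unit : A *m A^T \in unitmx.
Proof.
rewrite -row_free_unit -kermx_eq0; apply/eqP/row_matrixP => i.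
rewrite row0; set u := row i _.
have uAA : u *m (A *m A^T) = 0 by rewrite /u -row_mul mulmx_ker row0.
apply/eqP; rewrite -(mulmx_free_eq0 u (_ : row_free A)); last exact/eqP.
rewrite -trmx_eq0; apply/eqP/dot_eq0.
by rewrite /dot trmxK trmx_mul mulmxA -(mulmxA u) uAA mul0mx mxE.
Qed.

Definition rowproj : 'M[R]_n := A^T *m invmx (A *m A^T) *m A.
Local Notation Q := rowproj.

Lemma tr_rowproj : Q^T = Q.
Proof. by rewrite /Q !trmx_mul trmxK trmx_inv trmx_mul trmxK mulmxA. Qed.

Lemma mulmx_rowproj : A *m Q = A.
Proof. by rewrite /Q !mulmxA mulmxV ?mul1mx// gram_unit. Qed.

Lemma rowproj_idem (x : 'cV_n) : Q *m (Q *m x) = Q *m x.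
Proof.
by rewrite mulmxA; congr (_ *m _); rewrite {1}/Q -mulmxA mulmx_rowproj.
Qed.

Lemma dot_rowproj x y : dot (Q *m x) y = dot x (Q *m y).
Proof. by rewrite dot_mulmx tr_rowproj. Qed.

Lemma mulmx_x0 b : A *m x0 A b = b.
Proof. by rewrite /x0 !mulmxA mulmxV ?mul1mx// gram_unit. Qed.

Lemma rowproj_affine b y : A *m y = b -> Q *m y = x0 A b.
Proof. by move=> <-; rewrite /Q /x0 !mulmxA. Qed.

Lemma rowproj_x0 b : Q *m x0 A b = x0 A b.
Proof. exact/rowproj_affine/mulmx_x0. Qed.

Lemma proj_null_space x : Defs.proj (null_space A) x = x - Q *m x.
Proof.
apply: proj_eq => [|y yA]; rewrite /null_space/=.
  by rewrite mulmxBr mulmxA mulmx_rowproj subrr.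
rewrite subKr dot_rowproj mulmxBr mulmxBr rowproj_idem subrr subr0.
by rewrite /Q -(mulmxA _ A) (yA : A *m y = 0) mulmx0 dot0r.
Qed.

(** * The Douglas-Rachford operator *)

Section Operator.
Variables (K : set 'cV[R]_n) (b : 'cV[R]_m).
Hypotheses (K_nonempty : K !=set0) (K_closed : closed K).
Hypothesis K_convex : convex_set K.
Local Notation T := (T2 K A b).

Lemma T2E z : T z = Defs.proj K z - Q *m (2 *: Defs.proj K z - z) + x0 A b.
Proof.
rewrite /T2 /Ttilde /reflection proj_null_space; congr (_ + _).
move: (Defs.proj K z) => p; move: (Q *m _) => q.
by apply/matrixP => i j; rewrite !mxE; lra.
Qed.

(** With [a], [d] and [c] the differences of the projections on [K], of the
    arguments and of the terms [Q (2 p - z)], the inequality to prove is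
    [0 <= <a - c, d - (a - c)>].  Since [Q] is an orthogonal projector,
    [|c|^2 = <c, 2 a - d>], and what remains is [|a|^2 <= <a, d>], the firm
    nonexpansiveness of the projection on [K]. *)
Lemma T2_firmly_nonexpansive : firmly_nonexpansive T.
Proof.
move=> x y; have := proj_firm x y K_closed K_convex K_nonempty.
rewrite !T2E; move: (Defs.proj K x) (Defs.proj K y) => p q firmK.
have qE :
    Q *m (2 *: p - x) - Q *m (2 *: q - y) = Q *m (2 *: (p - q) - (x - y)).
  by rewrite -mulmxBr; congr (_ *m _); apply/matrixP => i j; rewrite !mxE; lra.
have : dot (Q *m (2 *: (p - q) - (x - y))) (Q *m (2 *: (p - q) - (x - y))) =
    dot (Q *m (2 *: (p - q) - (x - y))) (2 *: (p - q) - (x - y)).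
  by rewrite -dot_rowproj rowproj_idem.
rewrite -qE; move: (Q *m (2 *: p - x)) (Q *m (2 *: q - y)) (x0 A b) => u w r.
have -> : p - u + r - (q - w + r) = p - q - (u - w).
  by apply/matrixP => i j; rewrite !mxE; lra.
have -> : x - (p - u + r) - (y - (q - w + r)) = x - y - (p - q - (u - w)).
  by apply/matrixP => i j; rewrite !mxE; lra.
move: (p - q) (x - y) (u - w) firmK => a d c.
by rewrite !dot_lin (dotC d a) (dotC c a) (dotC c d); lra.
Qed.

(** The component of a displacement in the row space depends on [x] only
    through its projection on [K]. *)
Lemma dot_displacement x v : Q *m v = v ->
  dot (x - T x) v = dot (Q *m Defs.proj K x - x0 A b) v.
Proof.
move=> Qv; rewrite T2E -Qv -!dot_rowproj; congr dot; move: (Defs.proj K x) => p.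
rewrite !(mulmxDr, mulmxN) !rowproj_idem -scalemxAr.
move: (Q *m x) (Q *m p) (Q *m x0 A b) => a c d.
by apply/matrixP => i j; rewrite !mxE; lra.
Qed.

Lemma displacement_on_set p : K p -> p - T p = Q *m p - x0 A b.
Proof.
move=> Kp; have pE : Defs.proj K p = p.
  by apply: proj_eq => // y _; rewrite subrr dotC dot0r.
rewrite T2E pE; have -> : 2 *: p - p = p by rewrite scaler_nat mulr2n addrK.
by rewrite opprD addrA subKr.
Qed.

(** [v + x0] is the projection of [x0] on the closure of [Q K]. *)
Lemma exists_min_norm_rowproj : exists v,
  [/\ Q *m v = v,
      closure [set Q *m p - x0 A b | p in K] v
    & forall p, K p -> dot v v <= dot (Q *m p - x0 A b) v].
Proof.
pose M := [set Q *m p | p in K].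
have M_convex : convex_set M.
  move=> x y t; rewrite !inE => -[p Kp <-] [q Kq <-].
  exists (t%:num *: p + (1 - t%:num) *: q).
    by apply: convex_setE => //; apply/andP; split.
  by rewrite mulmxDr -!scalemxAr.
have [|w Mw wle] := closure_variational_projection (x0 A b) M_convex.
  by have [p Kp] := K_nonempty; exists (Q *m p), p.
have Qw : Q *m w = w.
  (* [w - Q w] is orthogonal to [Q K], hence to its limit point [w] *)
  apply/esym/eqP; rewrite -subr_eq0; apply/eqP/dot_eq0/le_anti.
  rewrite dot_ge0 andbT.
  have Qe : Q *m (w - Q *m w) = 0 by rewrite mulmxBr rowproj_idem subrr.
  rewrite dotDr dotNr -dot_rowproj Qe (dotC 0) dot0r subr0.
  rewrite -[X in dot _ X](subr0 w).
  apply: closure_halfspace Mw => _ [p _ <-].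
  by rewrite subr0 -dot_rowproj Qe dotC dot0r.
exists (w - x0 A b); split.
- by rewrite mulmxBr Qw rowproj_x0.
- apply/closure_dotP => e /((closure_dotP _ _).1 Mw)[_ [p Kp <-] pw].
  exists (Q *m p - x0 A b); first by exists p.
  by rewrite opprB addrA subrK.
- move=> p Kp; have := wle _ (ex_intro2 _ _ p Kp erefl).
  move: (Q *m p) (x0 A b) => q r.
  rewrite !dot_lin (dotC w q) (dotC r q) (dotC w r); lra.
Qed.

(** The first two properties identify [v] by [infimal_displacementE] and
    [cvg_displacement].  For the distance, if [A y = b] then
    [<x - y, v> = <Q x - x0, v> >= |v|^2]; conversely a point [x] of [K] and
    [y = x - (Q x - x0)] differ by [Q x - x0], which can be taken close to
    [v]. *)
Lemma exists_displacement : exists v,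
  [/\ closure (range (fun x => x - T x)) v,
      forall x, dot v v <= dot (x - T x) v
    & set_dist K (affine_set A b) = (enorm v)%:E].
Proof.
have [v [Qv vcl vle]] := exists_min_norm_rowproj; exists v; split.
- apply: closureS vcl => _ [p Kp <-].
  by exists p => //; rewrite displacement_on_set.
- move=> x; rewrite dot_displacement//; apply: vle.
  by case: (proj_variational x K_closed K_convex K_nonempty).
- apply/eqP; rewrite eq_le; apply/andP; split.
    apply/lee_addgt0Pr => e e0; rewrite -EFinD.
    have enorm_cvg : enorm w @[w --> v] --> enorm v.
      under eq_fun do rewrite enormE.
      rewrite enormE.
      exact: (continuous_cvg _ (@sqrt_continuous R _) (@sqnorm_continuous _ _ v)).
    have [_ [[p Kp <-] /= pv]] : [set Q *m p - x0 A b | p in K] `&`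
        [set w | enorm w < enorm v + e] !=set0.
      by apply: vcl; apply: cvgr_lt enorm_cvg _ _; rewrite ltrDl.
    apply: (@le_trans _ _ (enorm (Q *m p - x0 A b))%:E); last first.
      by rewrite lee_fin ltW.
    apply: ereal_inf_lbound; exists p => //; exists (p - (Q *m p - x0 A b)).
      rewrite /affine_set/= !mulmxBr mulmxA mulmx_rowproj mulmx_x0.
      by rewrite subKr.
    by rewrite subKr.
  apply: le_ereal_inf_tmp => _ [x Kx [y Ay <-]]; rewrite lee_fin enorm_le.
  have := vle _ Kx; rewrite -(rowproj_affine Ay) -mulmxBr dot_rowproj Qv.
  move: (x - y) => w; have := dot_ge0 (w - v).
  by rewrite !dot_lin (dotC v w); lra.
Qed.

End Operator.
End RowSpaceProjector.

(** * Infeasibility and the infimal displacement vector *)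

Theorem theorem6 (R : realType) (m n : nat) (K : set 'cV[R]_n)
    (A : 'M[R]_(m, n)) (b : 'cV[R]_m) (c : 'cV[R]_n)
    (K_nonempty : K !=set0) (K_closed : closed K) (K_convex : convex_set K)
    (K_cone : is_cone K) (m_le_n : (m <= n)%N)
    (A_full_rank : \rank A = minn m n) :
  let P := ConicProgram c A b K in
  let v := infimal_displacement (T2 K A b) in
  [/\ forall z : nat -> 'cV[R]_n,
        (forall k, z k.+1 = T2 K A b (z k)) ->
        (fun k => z k - z k.+1) @ \oo --> v,
      strongly_infeasible P <-> v != 0
    & (weakly_infeasible P \/ feasible P) <-> v = 0].
Proof.
move=> P v; have rankA : \rank A = m by rewrite A_full_rank; apply/minn_idPl.
have [w [wcl wle distE]] :=
  exists_displacement rankA b K_nonempty K_closed K_convex.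
have vE : v = w by exact: infimal_displacementE.
have dist0 : feasible P -> enorm w = 0.
  move=> [x [Kx Ax]]; apply/le_anti; rewrite {2}/enorm sqrtr_ge0 andbT -lee_fin.
  rewrite -distE; apply: ereal_inf_lbound; exists x => //; exists x => //.
  by rewrite subrr enormE dot0r sqrtr0.
have enorm0 : enorm w = 0 <-> w = 0.
  rewrite enormE; split=> [/eqP|->]; last by rewrite dot0r sqrtr0.
  rewrite sqrtr_eq0 => w0; apply/dot_eq0/le_anti; rewrite w0; exact: dot_ge0.
rewrite vE; split.
- move=> z zT; apply: cvg_displacement zT => //; exact: T2_firmly_nonexpansive.
- rewrite /strongly_infeasible/= distE lte_fin; split=> [[_]|w0].
    by apply: contraTneq => /enorm0->; rewrite ltxx.
  split; first by move=> /dist0/enorm0/eqP; exact/negP.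
  rewrite lt_neqAle {2}/enorm sqrtr_ge0 andbT eq_sym.
  by apply: contra_neq w0 => /enorm0.
- rewrite /weakly_infeasible/= distE.
  split=> [[[_ [/enorm0]]|/dist0/enorm0]//|w0].
  have [fP|nfP] := pselect (feasible P); [by right|left; split=> //].
  by rewrite (enorm0.2 w0).
Qed.
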